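(* Suppose $\phi$ is a positive M-shaped function. Then solutions exist to $$0=f''(x)-f^2(x)+\phi(x)\quad\text{for all }x\in\mathbb{R}.$$
   Context: $C_0^\infty(\mathbb{R})$ denotes the space of smooth real-valued functions on $\mathbb{R}$ that decay to zero at $\pm\infty$. A function $\phi\in C_0^\infty\cap L^\infty(\mathbb{R})$ is called M-shaped if there exists an $x_0>0$ such that for all $|x|>x_0$ one has $\phi(x)>0$, and $\phi$ is monotonic increasing for $x<-x_0$ and monotonic decreasing for $x>x_0$. Positive means $\phi(x)>0$ for all $x\in\mathbb{R}$. Solutions are real-valued and defined on all of $\mathbb{R}$. *)

(* Defs.v *)
(* Stdlib reals with Coquelicot. *)
From Stdlib Require Import Reals.
From Coquelicot Require Import Coquelicot.
Open Scope R_scope.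

Definition smooth (phi : R -> R) : Prop :=
  forall (n : nat) (x : R), ex_derive_n phi n x.

(* Only the function itself, not its derivatives, is asked to decay. *)
Definition C0_infty (phi : R -> R) : Prop :=
  smooth phi /\ is_lim phi p_infty 0 /\ is_lim phi m_infty 0.

(* For the continuous functions considered here, membership in L^oo
   (essential boundedness) is the same as boundedness. *)
Definition bounded_fun (phi : R -> R) : Prop :=
  exists M : R, forall x : R, Rabs (phi x) <= M.

(* Monotonicity is taken in the weak (non-strict) sense. *)
Definition M_shaped (phi : R -> R) : Prop :=
  C0_infty phi /\ bounded_fun phi /\
  exists x0 : R, 0 < x0 /\
    (forall x : R, x0 < Rabs x -> 0 < phi x) /\
    (forall x y : R, x <= y -> y < - x0 -> phi x <= phi y) /\
    (forall x y : R, x0 < x -> x <= y -> phi y <= phi x).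

Definition positive_fun (phi : R -> R) : Prop :=
  forall x : R, 0 < phi x.

(* [Derive] is total, so both orders of differentiability are required
   explicitly: differentiability of [Derive f] alone would not imply that
   of [f]. *)
Definition is_solution (phi f : R -> R) : Prop :=
  (forall x : R, ex_derive f x) /\
  (forall x : R, ex_derive (Derive f) x) /\
  (forall x : R, 0 = Derive_n f 2 x - f x ^ 2 + phi x).

(* Main.v *)
Require Import Defs.
From Stdlib Require Import Reals Lra.
From Coquelicot Require Import Coquelicot.
Open Scope R_scope.

(** The constant 0 is a subsolution of [f'' = f^2 - phi] because [phi >= 0],
    and any constant [B] with [phi <= B^2] is a supersolution, so a solution
    should exist with values in [0, B].  To find it, write the equation as
    [f'' - k^2 f = - (k^2 f - f^2 + phi)] with [k^2 = 2 B].  On [0, B] the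
    right-hand nonlinearity [s |-> k^2 s - s^2 + phi x] is nonnegative,
    nondecreasing and at most [2 B^2].

    Let [T g] be the bounded solution [u] of
    [u'' = k^2 u - (k^2 g - g^2 + phi)].  It exists and satisfies
    [0 <= u <= B] and [|u'| <= k B] ([bounded_solution_exists]), and it depends
    monotonically on [g] ([bounded_supersolution_nonneg]).  Both facts come from
    the factorisation [D^2 - k^2 = (D - k) (D + k)], which reduces them to the
    first-order equation [v' = h - k v] and its mirror image.

    Thus [T] is a monotone self-map of the set of [k B]-Lipschitz functions with
    values in [0, B].  This set is a complete lattice under pointwise suprema, a
    uniform Lipschitz bound being inherited by suprema, so the Knaster-Tarski
    argument applies: the supremum of all [g] with [g <= T g] is a fixed point of
    [T], that is, a solution.  No convergence of an iteration is involved. *)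

(** * The first-order equation *)

Lemma nondecreasing_of_derive_nonneg (F dF : R -> R) :
  (forall x, is_derive F x (dF x)) -> (forall x, 0 <= dF x) ->
  forall x y, x <= y -> F x <= F y.
Proof.
  intros HF Hpos x y Hxy.
  destruct (MVT_gen F x y dF) as [c [_ Hc]].
  - intros z _; apply HF.
  - intros z _; apply continuity_pt_filterlim.
    apply (ex_derive_continuous F z). exists (dF z); apply HF.
  - specialize (Hpos c). nra.
Qed.

(** The eta-expanded form is the one in which [auto_derive] leaves the
    derivative of an abstract function. *)
Lemma Derive_eta_eq (f : R -> R) (x l : R) :
  is_derive f x l -> Derive (fun y => f y) x = l.
Proof. apply is_derive_unique. Qed.

Lemma is_derive_exp_mult (k x : R) (v : R -> R) (l : R) :
  is_derive v x l ->
  is_derive (fun y => exp (k * y) * v y) x (exp (k * x) * (l + k * v x)).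
Proof.
  intros Hv. auto_derive.
  - exists l; exact Hv.
  - rewrite (Derive_eta_eq _ _ _ Hv). ring.
Qed.

(** [exp (k x) w x] is nondecreasing and, [w] being bounded, tends to 0 at
    minus infinity. *)
Lemma bounded_first_order_nonneg (k C : R) (w dw : R -> R) :
  0 < k ->
  (forall x, is_derive w x (dw x)) ->
  (forall x, 0 <= dw x + k * w x) ->
  (forall x, Rabs (w x) <= C) ->
  forall x, 0 <= w x.
Proof.
  intros Hk Hw Hsup Hbnd x.
  destruct (Rle_or_lt 0 (w x)) as [H | H]; [exact H | exfalso].
  assert (HC : 0 <= C).
  { apply Rle_trans with (2 := Hbnd x), Rabs_pos. }
  (* If [w x = -d < 0], then [d exp (k t) <= C] for all [t >= 0]; since
     [exp (k t) >= 1 + k t], the choice [t = C / (k d)] already fails. *)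
  set (d := - w x). assert (Hd : 0 < d) by (unfold d; lra).
  set (t := C / (k * d)).
  assert (Hkd : 0 < k * d) by nra.
  assert (Ht : 0 <= t) by (apply Rdiv_le_0_compat; assumption).
  assert (Hktd : k * t * d = C) by (unfold t; field; lra).
  assert (Hmono : exp (k * (x - t)) * w (x - t) <= exp (k * x) * w x).
  { apply (nondecreasing_of_derive_nonneg
             (fun y => exp (k * y) * w y)
             (fun y => exp (k * y) * (dw y + k * w y))); [| | lra].
    - intros y; apply is_derive_exp_mult, Hw.
    - intros y; apply Rmult_le_pos; [left; apply exp_pos | apply Hsup]. }
  replace (k * x) with (k * (x - t) + k * t) in Hmono by ring.
  rewrite exp_plus, Rmult_assoc in Hmono.
  apply Rmult_le_reg_l in Hmono; [| apply exp_pos].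
  destruct (Rabs_le_between (w (x - t)) C) as [Hlow _].
  specialize (Hlow (Hbnd _)).
  assert (Hexp : 1 + k * t <= exp (k * t)) by apply exp_ineq1_le.
  assert (exp (k * t) * d <= C) by (unfold d; lra).
  nra.
Qed.

(** The solution is [v x = exp (- k x)] times the integral of [exp (k y) h y]
    over [y <= x].  The improper integral is obtained as [P x - p], where [P] is
    the primitive from 0 and [p] its infimum. *)
Lemma bounded_first_order_exists (k H : R) (h : R -> R) :
  0 < k ->
  (forall x, continuous h x) ->
  (forall x, 0 <= h x <= H) ->
  exists v : R -> R,
    (forall x, is_derive v x (h x - k * v x)) /\
    (forall x, 0 <= v x <= H / k).
Proof.
  intros Hk Hcont Hh.
  set (g := fun y => exp (k * y) * h y).
  assert (Hg : forall x, continuous g x).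
  { intros x. apply (continuous_mult (fun y => exp (k * y)) h); [| apply Hcont].
    apply (ex_derive_continuous (fun y : R => exp (k * y))). auto_derive. exact I. }
  set (P := (fun x => RInt g 0 x) : R -> R).
  assert (HP : forall x, is_derive P x (g x)).
  { intros x. apply (is_derive_RInt g P 0 x); [| apply Hg].
    apply filter_forall. intros y. apply (RInt_correct g 0 y).
    apply ex_RInt_continuous. intros z _; apply Hg. }
  assert (Pmono : forall x y, x <= y -> P x <= P y).
  { apply (nondecreasing_of_derive_nonneg P g HP).
    intros x. apply Rmult_le_pos; [left; apply exp_pos | apply Hh]. }
  assert (Pgrowth : forall x y, x <= y ->
            H / k * exp (k * x) - P x <= H / k * exp (k * y) - P y).
  { apply (nondecreasing_of_derive_nonneg
             (fun x => H / k * exp (k * x) - P x)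
             (fun x => exp (k * x) * (H - h x))).
    - intros x. auto_derive.
      + exists (g x); apply HP.
      + rewrite (Derive_eta_eq _ _ _ (HP x)). unfold g. field. lra.
    - intros x. apply Rmult_le_pos; [left; apply exp_pos |].
      destruct (Hh x); lra. }
  assert (HHk : 0 <= H / k).
  { apply Rdiv_le_0_compat; [destruct (Hh 0); lra | exact Hk]. }
  assert (Plow : forall x y, P x - H / k * exp (k * x) <= P y).
  { intros x y. destruct (Rle_or_lt x y) as [Hxy | Hyx].
    - assert (0 < exp (k * x)) by apply exp_pos.
      specialize (Pmono x y Hxy). nra.
    - assert (0 < exp (k * y)) by apply exp_pos.
      specialize (Pgrowth y x (Rlt_le _ _ Hyx)). nra. }
  destruct (completeness (fun r => exists x, r = - P x)) as [q [Hub Hlub]].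
  { exists (H / k * exp (k * 0) - P 0). intros r [x ->].
    specialize (Plow 0 x). lra. }
  { exists (- P 0), 0. reflexivity. }
  exists (fun x => exp (- k * x) * (P x + q)). split.
  - intros x.
    assert (Hpq : is_derive (fun y => P y + q) x (g x)).
    { auto_derive; [exists (g x); apply HP |].
      rewrite (Derive_eta_eq _ _ _ (HP x)). ring. }
    replace (h x - k * (exp (- k * x) * (P x + q)))
      with (exp (- k * x) * (g x + - k * (P x + q))).
    + apply (is_derive_exp_mult (- k) x (fun y => P y + q)), Hpq.
    + unfold g.
      assert (E : exp (- k * x) * exp (k * x) = 1).
      { rewrite <- exp_plus, <- exp_0. f_equal. ring. }
      rewrite Rmult_plus_distr_l, <- Rmult_assoc, E. ring.
  - intros x.
    assert (He : 0 < exp (- k * x)) by apply exp_pos.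
    split.
    + apply Rmult_le_pos; [lra |].
      assert (- P x <= q) by (apply Hub; exists x; reflexivity). lra.
    + assert (Hq : q <= H / k * exp (k * x) - P x).
      { apply Hlub. intros r [y ->]. specialize (Plow x y). lra. }
      assert (E : exp (- k * x) * exp (k * x) = 1).
      { rewrite <- exp_plus, <- exp_0. f_equal. ring. }
      replace (H / k) with (exp (- k * x) * (H / k * exp (k * x))).
      * apply Rmult_le_compat_l; lra.
      * transitivity (H / k * (exp (- k * x) * exp (k * x))); [ring |].
        rewrite E. ring.
Qed.

(** * The second-order linear equation *)

Lemma is_derive_reflect (u : R -> R) (x l : R) :
  is_derive u (- x) l -> is_derive (fun y => u (- y)) x (- l).
Proof.
  intros Hu. auto_derive.
  - exists l; exact Hu.
  - rewrite (Derive_eta_eq _ _ _ Hu). ring.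
Qed.

(** With [v = k w - w'] the hypothesis reads [v' + k v >= 0], so [v >= 0]; then
    [w' <= k w], which is the first-order inequality for the reflection of [w]. *)
Lemma bounded_supersolution_nonneg (k C C' : R) (w dw ddw : R -> R) :
  0 < k ->
  (forall x, is_derive w x (dw x)) ->
  (forall x, is_derive dw x (ddw x)) ->
  (forall x, ddw x <= k ^ 2 * w x) ->
  (forall x, Rabs (w x) <= C) ->
  (forall x, Rabs (dw x) <= C') ->
  forall x, 0 <= w x.
Proof.
  intros Hk Hw Hdw Hsup HC HC' x.
  assert (Hv : forall y, 0 <= k * w y - dw y).
  { apply (bounded_first_order_nonneg k (k * C + C')
             (fun y => k * w y - dw y) (fun y => k * dw y - ddw y) Hk).
    - intros y. auto_derive.
      + split; [exists (dw y); apply Hw |].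
        split; [exists (ddw y); apply Hdw | exact I].
      + rewrite (Derive_eta_eq _ _ _ (Hw y)),
          (Derive_eta_eq _ _ _ (Hdw y)). ring.
    - intros y. specialize (Hsup y). nra.
    - intros y. specialize (HC y). specialize (HC' y).
      apply Rabs_le_between in HC. apply Rabs_le_between in HC'.
      apply Rabs_le_between. split; nra. }
  rewrite <- (Ropp_involutive x).
  apply (bounded_first_order_nonneg k C (fun y => w (- y)) (fun y => - dw (- y)) Hk).
  - intros y. apply is_derive_reflect, Hw.
  - intros y. specialize (Hv (- y)). lra.
  - intros y. apply HC.
Qed.

(** Solve [v' = h - k v], then [u' = k u - v]; the latter is again of the first
    form after reflection. *)
Lemma bounded_solution_exists (k H : R) (h : R -> R) :
  0 < k ->
  (forall x, continuous h x) ->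
  (forall x, 0 <= h x <= H) ->
  exists u du : R -> R,
    (forall x, is_derive u x (du x)) /\
    (forall x, is_derive du x (k ^ 2 * u x - h x)) /\
    (forall x, 0 <= u x <= H / k ^ 2) /\
    (forall x, Rabs (du x) <= H / k).
Proof.
  intros Hk Hcont Hh.
  destruct (bounded_first_order_exists k H h Hk Hcont Hh) as [v [Hv Hvb]].
  destruct (bounded_first_order_exists k (H / k) (fun x => v (- x)) Hk)
    as [z [Hz Hzb]].
  { intros x. apply (ex_derive_continuous (fun y => v (- y))).
    eexists. apply is_derive_reflect, Hv. }
  { intros x. apply Hvb. }
  set (u := fun x => z (- x)).
  assert (Hu : forall x, is_derive u x (k * u x - v x)).
  { intros x. replace (k * u x - v x) with (- (v (- - x) - k * z (- x))).
    - apply is_derive_reflect, Hz.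
    - rewrite Ropp_involutive. unfold u. ring. }
  assert (Hub : forall x, 0 <= u x <= H / k / k) by (intros x; apply Hzb).
  exists u, (fun x => k * u x - v x).
  split; [exact Hu |]. split; [| split].
  - intros x. auto_derive.
    + split; [eexists; apply Hu |]. split; [eexists; apply Hv | exact I].
    + rewrite (Derive_eta_eq _ _ _ (Hu x)),
        (Derive_eta_eq _ _ _ (Hv x)). ring.
  - intros x. replace (H / k ^ 2) with (H / k / k) by (field; lra). apply Hub.
  - intros x. destruct (Hub x) as [U0 U1]. destruct (Hvb x) as [V0 V1].
    assert (E : k * (H / k / k) = H / k) by (field; lra).
    assert (k * u x <= H / k) by (rewrite <- E; apply Rmult_le_compat_l; lra).
    assert (0 <= k * u x) by (apply Rmult_le_pos; lra).
    apply Rabs_le_between. lra.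
Qed.

(** * Bounded Lipschitz functions and the fixed point *)

Definition lipschitz (K : R) (g : R -> R) : Prop :=
  forall x y, g x <= g y + K * Rabs (x - y).

Definition in_lattice (K B : R) (g : R -> R) : Prop :=
  lipschitz K g /\ forall x, 0 <= g x <= B.

Lemma lipschitz_continuous (K : R) (g : R -> R) :
  0 < K -> lipschitz K g -> forall x, continuous g x.
Proof.
  intros HK Hg x. apply filterlim_locally. intros eps.
  assert (Hd : 0 < eps / K) by (apply Rdiv_lt_0_compat; [apply cond_pos | exact HK]).
  exists (mkposreal _ Hd). intros y Hy.
  change (Rabs (y - x) < eps / K) in Hy. change (Rabs (g y - g x) < eps).
  assert (Hlt : K * Rabs (y - x) < eps).
  { replace (pos eps) with (K * (eps / K)) by (field; lra).
    apply Rmult_lt_compat_l; assumption. }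
  pose proof (Hg x y) as H1. pose proof (Hg y x) as H2.
  rewrite Rabs_minus_sym in H1.
  apply Rabs_def1; lra.
Qed.

Lemma lipschitz_of_bounded_derive (K : R) (u du : R -> R) :
  (forall x, is_derive u x (du x)) -> (forall x, Rabs (du x) <= K) ->
  lipschitz K u.
Proof.
  intros Hu Hdu x y.
  destruct (MVT_gen u y x du) as [c [_ Hc]].
  - intros z _; apply Hu.
  - intros z _; apply continuity_pt_filterlim.
    apply (ex_derive_continuous u z). exists (du z); apply Hu.
  - assert (H1 : u x - u y <= Rabs (u x - u y)) by apply Rle_abs.
    rewrite Hc, Rabs_mult in H1.
    assert (Rabs (du c) * Rabs (x - y) <= K * Rabs (x - y)).
    { apply Rmult_le_compat_r; [apply Rabs_pos | apply Hdu]. }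
    lra.
Qed.

Lemma in_lattice_sup (K B : R) (S : (R -> R) -> Prop) :
  (exists g, S g) -> (forall g, S g -> in_lattice K B g) ->
  exists f, in_lattice K B f /\
    (forall g, S g -> forall x, g x <= f x) /\
    (forall u, (forall g, S g -> forall x, g x <= u x) -> forall x, f x <= u x).
Proof.
  intros [g0 Hg0] HS.
  assert (Hsup : forall x, {m | is_lub (fun r => exists g, S g /\ r = g x) m}).
  { intros x. apply completeness.
    - exists B. intros r [g [Hg ->]]. apply (HS g Hg).
    - exists (g0 x), g0. split; [exact Hg0 | reflexivity]. }
  assert (Hup : forall g, S g -> forall x, g x <= proj1_sig (Hsup x)).
  { intros g Hg x. apply (proj2_sig (Hsup x)). exists g; auto. }
  assert (Hleast : forall x b, (forall g, S g -> g x <= b) -> proj1_sig (Hsup x) <= b).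
  { intros x b Hb. apply (proj2_sig (Hsup x)). intros r [g [Hg ->]]. auto. }
  exists (fun x => proj1_sig (Hsup x)). split; [split | split].
  - intros x y. apply Hleast. intros g Hg.
    pose proof (proj1 (HS g Hg) x y). pose proof (Hup g Hg y). lra.
  - intros x. split.
    + apply Rle_trans with (2 := Hup g0 Hg0 x), (HS g0 Hg0).
    + apply Hleast. intros g Hg. apply (HS g Hg).
  - exact Hup.
  - intros u Hu x. apply Hleast. intros g Hg. apply Hu, Hg.
Qed.

(** Knaster-Tarski for a monotone map given by its graph [T]; single-valuedness
    of [T] is the case [g1 = g2] of monotonicity, up to pointwise equality. *)
Lemma in_lattice_fixed_point (K B : R) (T : (R -> R) -> (R -> R) -> Prop) :
  0 <= K -> 0 <= B ->
  (forall g, in_lattice K B g -> exists u, in_lattice K B u /\ T g u) ->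
  (forall g1 g2 u1 u2, in_lattice K B g1 -> in_lattice K B g2 ->
     (forall x, g1 x <= g2 x) -> T g1 u1 -> T g2 u2 -> forall x, u1 x <= u2 x) ->
  exists f u, in_lattice K B f /\ T f u /\ forall x, f x = u x.
Proof.
  intros HK HB Htotal Hmono.
  destruct (in_lattice_sup K B
    (fun g => in_lattice K B g /\ exists u, T g u /\ forall x, g x <= u x))
    as [f [Hf [Hup Hleast]]].
  { assert (H0 : in_lattice K B (fun _ => 0)).
    { split.
      - intros x y. pose proof (Rabs_pos (x - y)). nra.
      - intros x. lra. }
    exists (fun _ => 0). split; [exact H0 |].
    destruct (Htotal _ H0) as [u [Hu HT]]. exists u. split; [exact HT |].
    intros x. apply Hu. }
  { intros g [Hg _]. exact Hg. }
  destruct (Htotal f Hf) as [u [Hu HTu]].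
  exists f, u. split; [exact Hf |]. split; [exact HTu |].
  assert (Hfu : forall x, f x <= u x).
  { apply Hleast. intros g HSg x. pose proof HSg as [Hg [v [HTv Hgv]]].
    apply Rle_trans with (1 := Hgv x).
    apply (Hmono g f v u Hg Hf); [| exact HTv | exact HTu].
    apply Hup. exact HSg. }
  intros x. apply Rle_antisym; [apply Hfu |].
  apply Hup. split; [exact Hu |].
  destruct (Htotal u Hu) as [v [_ HTv]]. exists v. split; [exact HTv |].
  apply (Hmono f u u v Hf Hu Hfu HTu HTv).
Qed.

(** * The nonlinear equation *)

(** The upper bound on [phi] makes the constant [B = k^2 / 2] a supersolution;
    this [B] is the largest for which [s |-> k^2 s - s^2] is nondecreasing on
    [0, B]. *)
Lemma solution_exists_of_bounds (k : R) (phi : R -> R) :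
  0 < k ->
  (forall x, continuous phi x) ->
  (forall x, 0 <= phi x <= (k ^ 2 / 2) ^ 2) ->
  exists f df : R -> R,
    (forall x, is_derive f x (df x)) /\
    (forall x, is_derive df x (f x ^ 2 - phi x)).
Proof.
  intros Hk Hcont Hphi.
  set (B := k ^ 2 / 2) in *.
  set (K := k * B).
  assert (Hk2 : k ^ 2 = 2 * B) by (unfold B; field).
  assert (HB : 0 < B) by (unfold B; nra).
  assert (HK : 0 < K) by (unfold K; nra).
  set (src := fun (g : R -> R) x => k ^ 2 * g x - g x ^ 2 + phi x).
  set (T := fun g u : R -> R => exists du : R -> R,
    (forall x, is_derive u x (du x)) /\
    (forall x, is_derive du x (k ^ 2 * u x - src g x)) /\
    (forall x, 0 <= u x <= B) /\
    (forall x, Rabs (du x) <= K)).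
  destruct (in_lattice_fixed_point K B T) as [f [u [Hf [[du [Hu [Hdu _]]] Hfu]]]];
    [lra | lra | | |].
  - intros g [Hlip Hg].
    destruct (bounded_solution_exists k (2 * B ^ 2) (src g) Hk)
      as [u [du [Hu [Hdu [Hub Hdub]]]]].
    + intros x. pose proof (lipschitz_continuous K g HK Hlip x) as Hgx.
      apply (continuous_plus (fun y => k ^ 2 * g y - g y ^ 2) phi); [| apply Hcont].
      apply (continuous_comp g (fun s => k ^ 2 * s - s ^ 2)); [exact Hgx |].
      apply (ex_derive_continuous (fun s => k ^ 2 * s - s ^ 2)).
      auto_derive. exact I.
    + intros x. unfold src. rewrite Hk2.
      specialize (Hg x). specialize (Hphi x). nra.
    + assert (E2 : 2 * B ^ 2 / k ^ 2 = B) by (rewrite Hk2; field; lra).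
      assert (E1 : 2 * B ^ 2 / k = K) by (unfold K, B; field; lra).
      rewrite E2 in Hub. rewrite E1 in Hdub.
      exists u. split.
      * split; [apply (lipschitz_of_bounded_derive K u du Hu Hdub) | exact Hub].
      * exists du. auto.
  - intros g1 g2 u1 u2 [_ Hg1] [_ Hg2] Hle
      [du1 [Hu1 [Hdu1 [Hb1 Hdb1]]]] [du2 [Hu2 [Hdu2 [Hb2 Hdb2]]]] x.
    assert (Hsrc : forall y, src g1 y <= src g2 y).
    { intros y. unfold src. rewrite Hk2.
      specialize (Hg1 y). specialize (Hg2 y). specialize (Hle y).
      (* [(g2 - g1) (2 B - g1 - g2) >= 0] *)
      nra. }
    cut (0 <= u2 x - u1 x); [lra |].
    apply (bounded_supersolution_nonneg k B (2 * K)
      (fun y => u2 y - u1 y) (fun y => du2 y - du1 y)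
      (fun y => (k ^ 2 * u2 y - src g2 y) - (k ^ 2 * u1 y - src g1 y)) Hk).
    + intros y. apply (is_derive_minus u2 u1); auto.
    + intros y. apply (is_derive_minus du2 du1); auto.
    + intros y. specialize (Hsrc y). lra.
    + intros y. specialize (Hb1 y). specialize (Hb2 y).
      apply Rabs_le_between. lra.
    + intros y. pose proof (Hdb1 y) as D1. pose proof (Hdb2 y) as D2.
      apply Rabs_le_between in D1. apply Rabs_le_between in D2.
      apply Rabs_le_between. lra.
  - exists u, du. split; [exact Hu |]. intros x.
    replace (u x ^ 2 - phi x) with (k ^ 2 * u x - src f x); [apply Hdu |].
    unfold src. rewrite Hfu. ring.
Qed.

Theorem theorem38 (phi : R -> R) (phi_M : M_shaped phi)
    (phi_pos : positive_fun phi) :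
  exists f : R -> R, is_solution phi f.
Proof.
  destruct phi_M as [[Hsmooth _] [[M HM] _]].
  assert (HM0 : 0 <= M) by (apply Rle_trans with (2 := HM 0), Rabs_pos).
  (* For [k >= 2], [(k^2 / 2)^2 >= k^2 >= k], so [k = M + 2] is large enough. *)
  destruct (solution_exists_of_bounds (M + 2) phi) as [f [df [Hf Hdf]]].
  - lra.
  - intros x. apply (ex_derive_continuous phi x). exact (Hsmooth 1%nat x).
  - intros x. split; [left; apply phi_pos |].
    apply Rle_trans with (1 := Rle_abs (phi x)).
    apply Rle_trans with (1 := HM x).
    assert (M + 2 <= (M + 2) ^ 2 / 2) by nra. nra.
  - assert (HD : forall x, Derive f x = df x).
    { intros x. apply is_derive_unique, Hf. }
    assert (HDD : forall x, is_derive (Derive f) x (f x ^ 2 - phi x)).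
    { intros x. apply (is_derive_ext df); [intros y; symmetry; apply HD | apply Hdf]. }
    exists f. split; [| split].
    + intros x. exists (df x). apply Hf.
    + intros x. eexists. apply HDD.
    + intros x. change (Derive_n f 2 x) with (Derive (Derive f) x).
      rewrite (is_derive_unique _ _ _ (HDD x)). ring.
Qed.
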